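(* There exists a polynomial-time algorithm which, given as input a finite simple block graph $G$ in which each block has size at least three, computes the zero forcing number $Z(G)$.
   Context: Graphs are finite, simple and undirected. A block graph is a graph in which each maximal connected subgraph that cannot be disconnected by removing a single vertex is a clique; these cliques are called the blocks of the graph, and the size of a block is its number of vertices. Zero forcing number: initially every vertex of $G$ is unfilled. A player fills vertices using two rules. Rule 1: fill any vertex at the cost of one token. Rule 2 (forcing rule): at no cost, a filled vertex with a unique unfilled neighbor forces that neighbor to be filled. $Z(G)$ is the minimum number of tokens needed to fill all vertices of $G$; equivalently, it is the minimum size of a set $S\subseteq V(G)$ such that, starting with exactly the vertices of $S$ filled, repeated application of Rule 2 fills all of $V(G)$. Polynomial time means running time polynomial in the number of vertices of $G$. *)

(* Defs.v *)
From HB Require Import structures.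
From mathcomp Require Import all_boot.

Set Implicit Arguments.
Unset Strict Implicit.
Unset Printing Implicit Defensive.

(* A simple graph is a symmetric irreflexive relation on a finite type. *)
Section Graphs.
Variables (T : finType) (e : rel T).
Implicit Types (B S : {set T}).

Definition induced B : rel T := [rel x y | [&& x \in B, y \in B & e x y]].

Definition connected_set B : bool :=
  [forall x in B, forall y in B, connect (induced B) x y].

Definition nonseparable B : bool :=
  [&& B != set0, connected_set B & [forall v in B, connected_set (B :\ v)]].

(* Blocks are given by their vertex sets: adding edges preserves connectedness
   and nonseparability, so maximal nonseparable subgraphs are induced.  An
   isolated vertex is a block of size 1, a bridge is a block of size 2. *)
Definition block B : bool := maxset nonseparable B.

Definition clique B : bool :=
  [forall x in B, forall y in B, (x != y) ==> e x y].

Definition block_graph : Prop := forall B, block B -> clique B.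

(* With S filled, u may force w: w is the unique unfilled neighbour of u. *)
Definition can_force S (u w : T) : bool :=
  (u \in S) && [forall x, (e u x && (x \notin S)) == (x == w)].

Definition force_step : rel {set T} :=
  [rel S S' | [exists u, exists w, can_force S u w && (S' == w |: S)]].

Definition zero_forcing_set S : bool := connect force_step S [set: T].

(* The default [set: T] of the arg min is itself a zero forcing set. *)
Definition zero_forcing_number : nat :=
  #|[arg min_(S < [set: T] | zero_forcing_set S) #|S| ]|.

End Graphs.

(* Random access machine in the style of Cook and Reckhow, with a read-only
   input array.  Each instruction costs one step; since
   addition is the strongest arithmetic operation, the bit length of the
   largest number stored grows by at most one per step (up to a constant
   depending on the program and the input), so that polynomial time is the same
   as on Turing machines. *)
Inductive instr : Type :=
| Const of nat & nat          (* Const r a    : M[r] := a *)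
| Add of nat & nat & nat      (* Add r s t    : M[r] := M[s] + M[t] *)
| Sub of nat & nat & nat      (* Sub r s t    : M[r] := M[s] - M[t], truncated *)
| Fetch of nat & nat          (* Fetch r s    : M[r] := M[M[s]] *)
| Store of nat & nat          (* Store r s    : M[M[r]] := M[s] *)
| Read of nat & nat           (* Read r s     : M[r] := input[M[s]] *)
| JumpPos of nat & nat.       (* JumpPos r l  : if M[r] > 0, go to line l *)

Definition program := seq instr.

Record state := State { pc : nat; memory : nat -> nat }.

Definition update (m : nat -> nat) (r a : nat) : nat -> nat :=
  fun i => if i == r then a else m i.

Definition exec (input : seq nat) (i : instr) (s : state) : state :=
  let m := memory s in
  let assign r a := State (pc s).+1 (update m r a) in
  match i with
  | Const r a => assign r a
  | Add r u v => assign r (m u + m v)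
  | Sub r u v => assign r (m u - m v)
  | Fetch r u => assign r (m (m u))
  | Store r u => assign (m r) (m u)
  | Read r u => assign r (nth 0 input (m u))
  | JumpPos r l => if 0 < m r then State l m else State (pc s).+1 m
  end.

(* A machine whose program counter is outside the program has halted. *)
Definition halted (P : program) (s : state) : bool := size P <= pc s.

Definition step (P : program) (input : seq nat) (s : state) : state :=
  if onth P (pc s) is Some i then exec input i s else s.

Definition initial : state := State 0 (fun=> 0).

(* P halts on input after at most t steps, with output a in M[0]. *)
Definition computes_within (P : program) (input : seq nat) (t a : nat) : Prop :=
  let s := iter t (step P input) initial in halted P s /\ memory s 0 = a.

(* The number of vertices followed by the adjacency matrix, row by row. *)
Definition encode_graph (n : nat) (e : rel 'I_n) : seq nat :=
  n :: [seq nat_of_bool (e i j) | i <- enum 'I_n, j <- enum 'I_n].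

(* Main.v *)
Require Import Defs.
From HB Require Import structures.
From mathcomp Require Import all_boot.

Set Implicit Arguments.
Unset Strict Implicit.
Unset Printing Implicit Defensive.

(** The algorithm rests on the identity Z(G) = n - b, valid in every block graph
whose blocks all have at least three vertices, where b is the number of blocks.

Each force completes a block.  If u forces w, let B be the block of the edge
uw.  As B is a clique, all its vertices other than w are neighbours of u or u
itself, hence filled already.  So the number of filled vertices minus the
number of completely filled blocks never increases along a forcing process
([force_step_potential]), which gives Z(G) >= n - b.

Conversely, build G one block at a time, each new block B meeting the part H
built so far in a single vertex c.  As B has two vertices x and y besides c, it
is enough to add B minus {c, y} to the forcing set of H: until c is filled, no
force inside H is disturbed by the new vertices, and as soon as c is filled, x,
whose neighbours all lie in B, forces y ([forces_within_attach_block]).  Every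
block thus saves one token, and Z(G) <= n - b.  That B meets H only in c, with
no other edge between them, is the tree structure of blocks: a further
connection would close a cycle, and a cycle lies in one block
([grown_attachment]).

It remains to count blocks.  Two vertices of a block determine it, as the two
of them together with their common neighbours.  A block is therefore counted
once by its two smallest vertices i < j, and these are recognised among all
edges by having no common neighbour below j ([card_blocks]).  Three nested
loops over the adjacency matrix do this in cubic time; the loops are verified
with one rule for counted loops ([reaches_loop]). *)

(** * Nonseparable sets and cycles *)

Section Nonseparable.
Variables (T : finType) (e : rel T).
Hypothesis e_sym : symmetric e.
Implicit Types (B C D H S X : {set T}) (u v w x y z : T).

Lemma connected_setP B :
  reflect {in B &, forall x y, connect (induced e B) x y} (connected_set e B).
Proof.
apply: (iffP forall_inP) => [cB x y xB yB | cB x xB].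
  exact: (forall_inP (cB x xB)).
by apply/forall_inP => y yB; apply: cB.
Qed.

Lemma induced_sym B : symmetric (induced e B).
Proof. by move=> x y; rewrite /induced /= e_sym andbCA. Qed.

Lemma connect_induced_sym B : connect_sym (induced e B).
Proof. exact/sym_connect_sym/induced_sym. Qed.

Lemma connect_induced_sub B C x y :
  B \subset C -> connect (induced e B) x y -> connect (induced e C) x y.
Proof.
move/subsetP=> sBC; apply: connect_sub => {}x {}y /and3P [xB yB exy].
by apply: connect1; rewrite /induced /= !sBC.
Qed.

Lemma connected_setU B C z :
  z \in B -> z \in C -> connected_set e B -> connected_set e C ->
  connected_set e (B :|: C).
Proof.
move=> zB zC /connected_setP cB /connected_setP cC.
have to_z x : x \in B :|: C -> connect (induced e (B :|: C)) x z.
  case/setUP=> [xB | xC].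
    exact: connect_induced_sub (subsetUl _ _) (cB _ _ xB zB).
  exact: connect_induced_sub (subsetUr _ _) (cC _ _ xC zC).
apply/connected_setP => x y xU yU.
by rewrite (connect_trans (to_z x xU)) // connect_induced_sym to_z.
Qed.

Lemma connected_path x p : path e x p -> connected_set e [set z in x :: p].
Proof.
move=> e_p; set C := [set z in x :: p].
have iP : path (induced e C) x p.
  apply: (sub_in_path (P := mem (x :: p)) _ _ e_p); last exact/allP.
  by move=> y z yp zp eyz; apply/and3P; split; rewrite // inE.
have from_x y : y \in C -> connect (induced e C) x y.
  by rewrite inE => /(path_connect iP).
apply/connected_setP => y z yC zC.
by apply: (connect_trans _ (from_x z zC)); rewrite connect_induced_sym from_x.
Qed.

(** Deleting a vertex from a cycle, and rotating it to that vertex first, leaves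
a path. *)
Lemma nonseparable_cycle x c :
  uniq (x :: c) -> cycle e (x :: c) -> nonseparable e [set z in x :: c].
Proof.
have cyc_conn y d : cycle e (y :: d) -> connected_set e [set z in y :: d].
  by rewrite /= rcons_path => /andP [/connected_path].
move=> Uc Cc; apply/and3P; split.
- by apply/set0Pn; exists x; rewrite inE mem_head.
- exact: cyc_conn.
- apply/forall_inP => v; rewrite inE => v_c.
  have [i d Ed] := rot_to v_c.
  have mem_d z : z \in x :: c = (z \in v :: d) by rewrite -Ed mem_rot.
  move: Uc Cc; rewrite -(rot_uniq i) -(rot_cycle i e) Ed /= => /andP [v_d _].
  have -> : [set z in x :: c] :\ v = [set z in d].
    apply/setP=> z; rewrite in_setD1 [in LHS]inE mem_d !inE.
    by case: eqVneq => // ->; rewrite (negPf v_d).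
  case: d {Ed mem_d v_d} => [|y d] /=.
    by move=> _; apply/connected_setP => z t; rewrite inE.
  by rewrite rcons_path => /and3P [_ /connected_path].
Qed.

Lemma nonseparableD1 B v : nonseparable e B -> connected_set e (B :\ v).
Proof.
case/and3P=> _ cB /forall_inP cBv; have [/cBv // | vB] := boolP (v \in B).
by rewrite (setDidPl _) // disjoint_sym disjoints1.
Qed.

(** Whatever vertex is deleted, one of the two shared vertices survives and keeps
the two sets together. *)
Lemma nonseparableU B C u v :
  u != v -> u \in B -> u \in C -> v \in B -> v \in C ->
  nonseparable e B -> nonseparable e C -> nonseparable e (B :|: C).
Proof.
move=> neq_uv uB uC vB vC nB nC; apply/and3P; split.
- by apply/set0Pn; exists u; rewrite inE uB.
- by case/and3P: nB nC => _ cB _ /and3P [_ cC _]; apply: (connected_setU uB uC).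
apply/forall_inP => w _; rewrite setDUl.
have [z [zB zC zw]] : exists z, [/\ z \in B, z \in C & z != w].
  have [<- | neq_uw] := eqVneq u w; last by exists u.
  by exists v; rewrite eq_sym.
by apply: (@connected_setU _ _ z); rewrite ?nonseparableD1 // !inE zw.
Qed.

Lemma block_nonseparable B : block e B -> nonseparable e B.
Proof. by case/maxsetP. Qed.

Lemma block_max B C : block e B -> nonseparable e C -> B \subset C -> C = B.
Proof. by case/maxsetP=> _; apply. Qed.

Lemma nonseparable_sub_block C :
  nonseparable e C -> exists2 B, block e B & C \subset B.
Proof. by case/maxset_exists=> B; exists B. Qed.

Lemma block_eq B C u v :
  block e B -> block e C ->
  u != v -> u \in B -> v \in B -> u \in C -> v \in C -> B = C.
Proof.
move=> bB bC neq_uv uB vB uC vC.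
have nU : nonseparable e (B :|: C).
  by apply: (@nonseparableU _ _ u v); rewrite ?block_nonseparable.
by rewrite -(block_max bB nU (subsetUl _ _)) (block_max bC nU (subsetUr _ _)).
Qed.

(** The source of the tree-like behaviour of blocks.  The degenerate cycle
[:: u; v] is allowed: it is an edge, so that every edge lies in a block. *)
Lemma cycle_in_block x c :
  uniq (x :: c) -> cycle e (x :: c) ->
  exists2 B, block e B & {subset x :: c <= B}.
Proof.
move=> Uc Cc; have [B bB /subsetP sB] :=
  nonseparable_sub_block (nonseparable_cycle Uc Cc).
by exists B => // z zc; apply: sB; rewrite inE.
Qed.

End Nonseparable.

(** * Zero forcing in block graphs *)

Section BlockGraph.
Variables (T : finType) (e : rel T).
Hypotheses (e_sym : symmetric e) (e_irr : irreflexive e).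
Hypothesis e_block : block_graph e.
Implicit Types (B C D H S X : {set T}) (u v w x y z : T).

Lemma edge_neq u v : e u v -> u != v.
Proof. by apply: contraTneq => ->; rewrite e_irr. Qed.

Lemma edge_in_block u v :
  e u v -> exists B, [/\ block e B, u \in B & v \in B].
Proof.
move=> euv; have [||B bB sB] := @cycle_in_block _ e e_sym u [:: v].
- by rewrite /= inE edge_neq.
- by rewrite /= euv e_sym euv.
by exists B; split; rewrite ?sB ?inE ?eqxx ?orbT.
Qed.

Lemma block_edge B u v : block e B -> u \in B -> v \in B -> u != v -> e u v.
Proof.
move=> /e_block /forall_inP cB uB vB.
exact/implyP/(forall_inP (cB u uB)).
Qed.

(** The triangle on u, v and x lies in a block, which shares u and v with B. *)
Lemma block_common_neighbor B u v x :
  block e B -> u \in B -> v \in B -> e u v -> e u x -> e v x -> x \in B.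
Proof.
move=> bB uB vB euv eux evx.
have [||C bC sC] := @cycle_in_block _ e e_sym u [:: v; x].
- by rewrite /= !inE negb_or !edge_neq.
- by rewrite /= euv evx e_sym eux.
rewrite (block_eq e_sym bB bC (edge_neq euv)) ?uB ?vB ?sC ?inE ?eqxx ?orbT //.
Qed.

Definition blocks_in S := [set B | block e B && (B \subset S)].

(** The force of w by u completes the block of the edge uw, so that at least one
block becomes filled for the one vertex that does. *)
Lemma force_step_potential S S' :
  force_step e S S' -> #|S'| + #|blocks_in S| <= #|S| + #|blocks_in S'|.
Proof.
case/existsP=> u /existsP [w /andP [/andP [uS /forallP forced] /eqP ->]].
have /andP [euw wS] : e u w && (w \notin S) by rewrite (eqP (forced w)).
have [B [bB uB wB]] := edge_in_block euw.
rewrite cardsU1 wS add1n addSnnS leq_add2l.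
have BS : B \notin blocks_in S.
  by rewrite inE bB; apply: contra wS => /subsetP; apply.
have -> : #|blocks_in S|.+1 = #|B |: blocks_in S| by rewrite cardsU1 BS.
apply/subset_leq_card/subsetP => C /setU1P [-> | ].
  rewrite inE bB; apply/subsetP => x xB; apply/setU1P.
  have [-> | neq_xu] := eqVneq x u; first by right.
  have := forced x; rewrite (block_edge bB uB xB) 1?eq_sym //=.
  by case: (x \in S) => [_ | /eqP/eqP]; [right | left].
by rewrite !inE => /andP [-> sC]; apply: subset_trans sC (subsetUr _ _).
Qed.

Lemma zero_forcing_potential S S' :
  connect (force_step e) S S' ->
  #|S'| + #|blocks_in S| <= #|S| + #|blocks_in S'|.
Proof.
case/connectP=> p; elim: p S => [|S1 p IH] S /= => [_ -> // | ].
case/andP=> /force_step_potential le1 /IH /[apply] le2.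
rewrite -(leq_add2r #|blocks_in S1|) addnAC.
rewrite (leq_trans (leq_add le2 (leqnn _))) //.
by rewrite addnAC [leqRHS]addnAC leq_add2r.
Qed.

Lemma zero_forcing_lower_bound S :
  zero_forcing_set e S -> #|T| <= #|S| + #|[set B | block e B]|.
Proof.
move/zero_forcing_potential; rewrite cardsT => /(leq_trans (leq_addr _ _)).
move=> /leq_trans; apply; rewrite leq_add2l subset_leq_card //.
by apply/subsetP => B; rewrite !inE => /andP [].
Qed.


Hypothesis block_ge3 : forall B, block e B -> 3 <= #|B|.

Lemma block_other x B : block e B -> exists2 y, y \in B & y != x.
Proof.
move=> bB; suff /subsetPn [y yB] : ~~ (B \subset [set x]).
  by rewrite inE; exists y.
apply/negP => /subset_leq_card; rewrite cards1 leqNgt.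
by rewrite (leq_trans _ (block_ge3 bB)).
Qed.

(** Zero forcing in the subgraph induced by H, with chronologies eliminated: a set
forces H when no proper subset of H containing it is closed under forcing. *)
Definition forces_within H S : Prop :=
  forall X, S \subset X -> X \proper H ->
    exists u w, [/\ u \in X, w \in H :\: X &
                 forall x, (e u x && (x \in H :\: X)) = (x == w)].

Lemma forces_within_setT S : forces_within [set: T] S -> zero_forcing_set e S.
Proof.
move=> fS; suff: forall X, S \subset X -> connect (force_step e) X setT by apply.
move=> X; have [m le_m] := ubnP #|~: X|; elim: m X le_m => // m IH X le_m SX.
have [-> // | ] := eqVneq X setT; rewrite -properT => /(fS X SX).
case=> u [w [uX]]; rewrite setTD inE => wX fw.
apply: (connect_trans (y := w |: X)).
  apply/connect1/existsP; exists u; apply/existsP; exists w.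
  rewrite eqxx andbT /can_force uX; apply/forallP => x.
  by rewrite -fw inE.
apply: IH; last exact: subset_trans SX (subsetUr _ _).
rewrite -ltnS (leq_trans _ le_m) // ltnS proper_card //.
rewrite properEneq setCS subsetUr andbT; apply: contraNneq wX => eq_w.
by have := setU11 w X; rewrite -(setCK (w |: X)) eq_w setCK.
Qed.

(** The invariant of the construction of G block by block.  The first condition
says that at most one piece of each component of G has been built, and the
second that the built part meets no block in more than one vertex without
containing it. *)
Definition grown H : Prop :=
  {in H &, forall x y, connect e x y -> connect (induced e H) x y} /\
  (forall B u v, block e B -> u != v -> u \in B -> v \in B -> u \in H ->
     v \in H -> B \subset H).

(** An edge from y to a second vertex h of H would close a cycle with a path from
c to h in H.  The block of this cycle would contain y, and would be contained in
H because it shares c and h with H. *)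
Lemma grown_attachment H B c y h :
  grown H -> block e B -> c \in H -> c \in B -> y \in B -> y \notin H ->
  h \in H -> e y h -> h = c.
Proof.
move=> [connH closedH] bB cH cB yB yH hH eyh; apply/eqP/negP => /negP neq_hc.
have neq_cy : c != y by apply: contraNneq yH => <-.
have ecy := block_edge bB cB yB neq_cy.
have /connectP [p0] : connect (induced e H) c h.
  by apply: connH => //; apply: connect_trans (connect1 ecy) (connect1 eyh).
case/shortenP=> p p_path Up _ h_last.
have pH : {subset c :: p <= H}.
  move=> z; rewrite inE => /predU1P [-> // | zp].
  case/splitPr: zp p_path => p1 p2; rewrite cat_path /=.
  by case/and3P=> _ /and3P [].
have e_p : path e c p by apply: sub_path p_path => ? ? /and3P [].
have [||D bD sD] := @cycle_in_block _ e e_sym y (c :: p).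
- by rewrite cons_uniq Up andbT; apply: contra yH => /pH.
- by rewrite /= rcons_path -h_last e_p e_sym ecy e_sym eyh.
have yD : y \in D by rewrite sD ?mem_head.
have cD : c \in D by rewrite sD // !inE eqxx orbT.
have hD : h \in D by rewrite sD // inE h_last mem_last orbT.
by rewrite (subsetP (closedH D h c bD neq_hc hD cD hH cH)) in yH.
Qed.

Lemma grown_attach_block H B c :
  grown H -> block e B -> c \in H -> c \in B ->
  grown (H :|: B).
Proof.
move=> grH bB cH cB; have [connH closedH] := grH.
have attach := grown_attachment grH bB cH cB.
split=> [x y xU yU exy | D u v bD neq_uv uD vD uU vU].
  have toH z : z \in H :|: B ->
      exists2 z0, z0 \in H & connect (induced e (H :|: B)) z z0.
    have [zH _ | zH] := boolP (z \in H); first by exists z.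
    rewrite inE (negPf zH) /= => zB; exists c => //; apply: connect1.
    apply/and3P; split; rewrite ?inE ?zB ?cH ?orbT //.
    by apply: block_edge bB zB cB _; apply: contraNneq zH => ->.
  have sub_e x1 y1 : connect (induced e (H :|: B)) x1 y1 -> connect e x1 y1.
    by apply: connect_sub => ? ? /and3P [_ _ /connect1].
  have [x0 x0H xx0] := toH x xU; have [y0 y0H yy0] := toH y yU.
  have yy0' : connect (induced e (H :|: B)) y0 y by rewrite connect_induced_sym.
  apply: (connect_trans xx0); apply: connect_trans yy0'.
  apply: connect_induced_sub (subsetUl _ _) _; apply: connH => //.
  apply: connect_trans (sub_e _ _ yy0); apply: connect_trans exy.
  by rewrite sym_connect_sym // sub_e.
have meet_B a b : a \in D -> b \in D -> a != b -> a \in H -> b \in B ->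
    D \subset H :|: B.
  move=> aD bD' neq_ab aH b_B.
  have [b_H | b_H] := boolP (b \in H).
    exact: subset_trans (closedH D a b bD neq_ab aD bD' aH b_H) (subsetUl _ _).
  have eq_ac : a = c.
    by apply: attach b_B b_H aH _; apply: block_edge bD _ _ _; rewrite // eq_sym.
  by rewrite (block_eq e_sym bD bB neq_ab) ?subsetUr // eq_ac.
case/setUP: uU => [uH | uB]; case/setUP: vU => [vH | vB].
- exact: subset_trans (closedH D u v bD neq_uv uD vD uH vH) (subsetUl _ _).
- exact: meet_B uD vD neq_uv uH vB.
- by apply: meet_B vD uD _ vH uB; rewrite eq_sym.
- by rewrite (block_eq e_sym bD bB neq_uv) ?subsetUr.
Qed.

(** A new block D contains a vertex y of B outside H, and a second vertex h.  If h
is in H, then it is adjacent to y, so it is c.  Thus D shares y and h with B. *)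
Lemma blocks_in_attach_block H B c :
  grown H -> block e B -> c \in H -> c \in B ->
  blocks_in (H :|: B) \subset B |: blocks_in H.
Proof.
move=> grH bB cH cB; apply/subsetP => D; rewrite !inE => /andP [bD sD]; rewrite bD /=.
have [|] := boolP (D \subset H); first by rewrite orbT.
case/subsetPn=> y yD yH; rewrite orbF; apply/eqP.
have yB : y \in B by have := subsetP sD y yD; rewrite inE (negPf yH).
have [h hD neq_hy] := block_other y bD.
have hB : h \in B.
  have /setUP [hH | //] := subsetP sD h hD.
  rewrite (grown_attachment grH bB cH cB yB yH hH) //.
  by apply: block_edge bD _ _ _; rewrite // eq_sym.
exact: (block_eq e_sym bD bB neq_hy).
Qed.

(** The new vertices disturb no force inside H before c is filled, since c is the
only vertex of H with neighbours among them; once c is filled, x forces y. *)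
Lemma forces_within_attach_block H S B c x y :
  grown H -> block e B -> c \in H -> c \in B ->
  x \in B -> x \notin H -> y \in B -> y \notin H -> x != y ->
  S \subset H -> forces_within H S ->
  forces_within (H :|: B) (S :|: (B :\: [set c; y])).
Proof.
move=> grH bB cH cB xB xH yB yH neq_xy SH fS X.
rewrite subUset => /andP [SX BX] XU.
have attach := grown_attachment grH bB cH cB.
have {}BX z : z \in B -> z != y -> c \in X -> z \in X.
  move=> zB neq_zy cX; apply: contraLR BX => zX.
  apply/subsetPn; exists z; rewrite // !inE zB (negPf neq_zy) orbF andbT.
  by apply: contraNneq zX => ->.
(* Either x can force y, or a force inside H is still possible. *)
case: (boolP ((c \in X) && (y \notin X))) => [/andP [cX yX] | cyX].
  exists x, y; split=> [||z]; [exact: BX | by rewrite !inE yX yB orbT | ].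
  rewrite !inE; apply/idP/eqP => [/and3P [exz zX /orP zU] | ->]; last first.
    by rewrite (block_edge bB) // yX yB orbT.
  apply/eqP/negPn; apply: contra zX => zy.
  case: zU => [zH | zB]; last exact: BX.
  by rewrite (attach x z).
have {}BX z : z \in B -> c \in X -> z \in X.
  move=> zB cX; have [-> | /BX-> //] := eqVneq z y.
  by rewrite cX negbK in cyX.
have XH : X :&: H \proper H.
  rewrite properE subsetIr subsetI subxx andbT /=; apply/negP => HX.
  case/properP: XU => _ [z /setUP [/(subsetP HX) -> // | zB]].
  by rewrite BX // (subsetP HX).
have [|u [w [/setIP [uX uH] wH fw]]] := fS (X :&: H) _ XH.
  by rewrite subsetI SX.
exists u, w; split=> // [|z].
  by case/setDP: wH => wH; rewrite !inE wH !andbT => ->.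
rewrite -fw; apply: andb_id2l => euz; rewrite !inE.
have [zH | zH] := boolP (z \in H); rewrite ?andbT ?andbF //=.
apply/negP => /andP [zX zB]; case/negP: zX; apply: BX => //.
by rewrite -(attach z u) // e_sym.
Qed.

(** When no edge leaves H, the construction starts on another component with a
single vertex x; no block is completed by it. *)
Lemma grown_add_vertex H x :
  grown H -> closed e H -> x \notin H -> grown (x |: H).
Proof.
move=> [connH closedH] clH xH.
have no_edge y : y \in H -> e x y = false.
  by move=> yH; apply/negP => /clH; rewrite yH (negPf xH).
split=> [y z | D u v bD neq_uv uD vD].
  have no_path t : t \in H -> connect e x t = false.
    by move=> tH; apply/negP => /(closed_connect clH); rewrite tH (negPf xH).
  case/setU1P=> [-> | yH] /setU1P [-> | zH] //; rewrite ?no_path //.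
    by rewrite sym_connect_sym // no_path.
  by move=> /(connH y z yH zH); apply: connect_induced_sub (subsetUr _ _).
have euv := block_edge bD uD vD neq_uv.
case/setU1P=> [Eu | uH] /setU1P [Ev | vH].
- by rewrite Eu Ev eqxx in neq_uv.
- by rewrite Eu no_edge in euv.
- by rewrite Ev e_sym no_edge in euv.
- exact: subset_trans (closedH D u v bD neq_uv uD vD uH vH) (subsetUr _ _).
Qed.

Lemma blocks_in_add_vertex H x :
  closed e H -> x \notin H -> blocks_in (x |: H) \subset blocks_in H.
Proof.
move=> clH xH; apply/subsetP => D; rewrite !inE => /andP [bD sD].
rewrite bD; apply/subsetP => y yD.
have /setU1P [Eyx | //] := subsetP sD y yD; rewrite Eyx in yD *.
have [z zD neq_zx] := block_other x bD.
have /setU1P [/eqP | zH] := subsetP sD z zD; first by rewrite (negPf neq_zx).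
by rewrite (clH x z) // (block_edge bD) // eq_sym.
Qed.

Lemma forces_within_add_vertex H S x :
  S \subset H -> x \notin H -> forces_within H S ->
  forces_within (x |: H) (x |: S).
Proof.
move=> SH xH fS X; rewrite subUset sub1set => /andP [xX SX] XxH.
have XH : X :&: H \proper H.
  rewrite properE subsetIr subsetI subxx andbT /=; apply/negP => HX.
  by case/properP: XxH => _ [z /setU1P [-> | /(subsetP HX) ->]]; rewrite ?xX.
have [|u [w [/setIP [uX uH] /setDP [wH wX] fw]]] := fS (X :&: H) _ XH.
  by rewrite subsetI SX.
have eq_D : (x |: H) :\: X = H :\: (X :&: H).
  apply/setP => z; rewrite !inE; case: eqVneq => [-> | _] /=.
    by rewrite xX (negPf xH) andbF.
  by case: (z \in H); rewrite ?andbT ?andbF.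
by exists u, w; rewrite eq_D; split=> //; apply/setDP.
Qed.

(** The construction, by induction on the number of vertices outside H.  Attaching
a block to H at c adds all its vertices but c to H, all but c and y to the
forcing set, and at most one block to those contained in H. *)
Lemma zero_forcing_upper_bound :
  exists2 S, zero_forcing_set e S & #|S| + #|[set B | block e B]| <= #|T|.
Proof.
suff grow H S : S \subset H -> grown H -> forces_within H S ->
    #|S| + #|blocks_in H| <= #|H| ->
    exists2 S, zero_forcing_set e S & #|S| + #|[set B | block e B]| <= #|T|.
  apply: (grow set0 set0) => //.
  - by split=> [x | B u v _ _ _ _]; rewrite inE.
  - by move=> X _ /proper_sub_trans/(_ (sub0set X)); rewrite properxx.
  - rewrite !cards0 leqn0 cards_eq0 -subset0; apply/subsetP => B.
    rewrite inE subset0 => /andP [/block_ge3 B3 /eqP B0].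
    by rewrite B0 cards0 in B3.
have [m le_m] := ubnP #|~: H|.
elim: m H S le_m => // m IH H S le_m SH grH fS le_S.
have lt_m (K : {set T}) : H \subset K -> ~~ (K \subset H) -> #|~: K| < m.
  move=> HK KH; rewrite -ltnS (leq_trans _ le_m) // ltnS proper_card //.
  by rewrite properE !setCS HK.
have [outH | ] := boolP [exists c in H, exists x, e c x && (x \notin H)].
  case/exists_inP: outH => c cH /existsP [x /andP [ecx xH]].
  have [B [bB cB xB]] := edge_in_block ecx.
  have BH : ~~ (B \subset H) by apply/subsetPn; exists x.
  have attach := grown_attachment grH bB cH cB.
  have BHc : B :&: H = [set c].
    apply/setP => z; rewrite !inE; apply/andP/eqP => [[zB zH] | -> //].
    apply: (attach x z) => //; apply: (block_edge bB) => //.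
    by apply: contraNneq xH => ->.
  have [y yB] : exists2 y, y \in B & y \notin [set c; x].
    apply/subsetPn/negP => /subset_leq_card; rewrite cards2 leqNgt.
    by rewrite (leq_trans _ (block_ge3 bB)) //; case: (c != x).
  rewrite !inE negb_or => /andP [neq_yc neq_yx].
  have yH : y \notin H.
    apply/negP => yH; have : y \in B :&: H by rewrite inE yB.
    by rewrite BHc inE (negPf neq_yc).
  apply: (IH (H :|: B) (S :|: (B :\: [set c; y]))).
  - by apply: lt_m; rewrite ?subsetUl // subUset subxx.
  - by apply: setUSS SH _; apply: subsetDl.
  - exact: grown_attach_block cB.
  - by apply: (@forces_within_attach_block _ _ _ _ x); rewrite // eq_sym.
  (* The left side grows by at most (|B| - 2) + 1, the right side by |B| - 1. *)
  have le_b : #|blocks_in (H :|: B)| <= #|blocks_in H|.+1.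
    have sub_b := blocks_in_attach_block grH bB cH cB.
    rewrite (leq_trans (subset_leq_card sub_b)) //.
    by rewrite cardsU1; case: (_ \notin _).
  have cyB : [set c; y] \subset B by rewrite subUset !sub1set cB.
  have card_B : #|B :\: [set c; y]|.+2 = #|B|.
    by rewrite -(cardsID [set c; y] B) (setIidPr cyB) cards2 eq_sym neq_yc.
  have := cardsUI H B; rewrite setIC BHc cards1 addn1 -card_B !addnS => -[card_U].
  rewrite card_U (leq_trans (leq_add (leq_card_setU _ _) le_b)) //.
  by rewrite addnS ltnS addnAC leq_add2r.
rewrite negb_exists_in => /forall_inP noOut.
have clH : closed e H.
  apply: (intro_closed (sym_connect_sym e_sym)) => c x ecx cH.
  apply: contraTT ecx => xH.
  by have := noOut c cH; rewrite negb_exists => /forallP /(_ x); rewrite xH andbT.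
have [HT | ] := eqVneq H setT.
  exists S; first by apply: forces_within_setT; rewrite -HT.
  move: le_S; rewrite HT cardsT; congr (_ + #|pred_of_set _| <= _).
  by apply/setP => B; rewrite !inE subsetT andbT.
rewrite -subTset => /subsetPn [x _ xH].
have xS : x \notin S by apply: contra xH => /(subsetP SH).
apply: (IH (x |: H) (x |: S)).
- by apply: lt_m; rewrite ?subsetUr // subUset sub1set negb_and xH.
- exact: setUS.
- exact: grown_add_vertex.
- exact: forces_within_add_vertex.
rewrite !cardsU1 xH xS !add1n addSn ltnS (leq_trans _ le_S) // leq_add2l.
by rewrite subset_leq_card ?blocks_in_add_vertex.
Qed.

Theorem zero_forcing_number_block_graph :
  zero_forcing_number e = #|T| - #|[set B | block e B]|.
Proof.
rewrite /zero_forcing_number; case: arg_minnP => [|S zS minS].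
  exact: connect0.
apply/eqP; rewrite eqn_leq leq_subLR addnC zero_forcing_lower_bound // andbT.
have [S0 /minS le_S le_S0] := zero_forcing_upper_bound.
rewrite (leq_trans le_S) // leq_subRL; last exact: leq_trans (leq_addl _ _) le_S0.
by rewrite addnC.
Qed.

End BlockGraph.

(** * Counting blocks by their two smallest vertices *)

Section CountBlocks.
Variables (n : nat) (e : rel 'I_n).
Hypotheses (e_sym : symmetric e) (e_irr : irreflexive e).
Hypothesis e_block : block_graph e.
Hypothesis block_ge3 : forall B, block e B -> 3 <= #|B|.
Implicit Types (B : {set 'I_n}) (i j k : 'I_n).

Definition leading_pair i j : bool :=
  [&& i < j, e i j & [forall k : 'I_n, (k < j) ==> ~~ (e i k && e j k)]].

Definition pair_block (p : 'I_n * 'I_n) : {set 'I_n} :=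
  p.1 |: (p.2 |: [set k | e p.1 k && e p.2 k]).

Lemma block_pair_block B i j :
  block e B -> i \in B -> j \in B -> e i j -> B = pair_block (i, j).
Proof.
move=> bB iB jB eij; apply/setP => k; rewrite !inE /=.
apply/idP/or3P => [kB | [/eqP -> // | /eqP -> // | /andP [eik ejk]]]; last first.
  exact: block_common_neighbor bB iB jB eij eik ejk.
have [_ | neq_ki] := eqVneq k i; first by constructor 1.
have [_ | neq_kj] := eqVneq k j; first by constructor 2.
by constructor 3; rewrite !(block_edge e_block bB) // eq_sym.
Qed.

(** A leading pair is recovered from its block: a vertex of the block below the
larger element of the pair can only be the smaller one. *)
Lemma pair_block_inj :
  {in [set p | leading_pair p.1 p.2] &, injective pair_block}.
Proof.
have small p k : leading_pair p.1 p.2 -> k \in pair_block p -> k < p.2 -> k = p.1.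
  case/and3P=> _ _ /forallP noC; rewrite !inE => kB lt_k.
  have := noC k; rewrite lt_k /= => /negPf Nk.
  move: kB; rewrite Nk orbF => /predU1P [// | /eqP Ek].
  by rewrite Ek ltnn in lt_k.
have mem1 p : p.1 \in pair_block p by rewrite !inE eqxx.
have mem2 p : p.2 \in pair_block p by rewrite !inE eqxx orbT.
have le2 p q : leading_pair p.1 p.2 -> leading_pair q.1 q.2 ->
    pair_block p = pair_block q -> p.2 <= q.2.
  move=> Lp Lq Epq; rewrite leqNgt; apply/negP => lt_qp.
  have E2 : q.2 = p.1 by apply: small; rewrite // Epq.
  have lt_q : q.1 < q.2 by case/and3P: Lq.
  have E1 : q.1 = p.1 by apply: small; rewrite ?Epq // (ltn_trans lt_q).
  by rewrite E2 E1 ltnn in lt_q.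
move=> p q; rewrite !inE => Lp Lq Epq.
have E2 : p.2 = q.2.
  by apply/val_inj/eqP; rewrite /= eqn_leq !le2 // Epq.
have E1 : p.1 = q.1.
  by apply: small; rewrite // -?Epq // -E2; case/and3P: Lp.
by rewrite (surjective_pairing p) (surjective_pairing q) E1 E2.
Qed.

Lemma block_leading_pair B :
  block e B -> exists2 p, leading_pair p.1 p.2 & B = pair_block p.
Proof.
move=> bB; have /set0Pn [i0 i0B] : B != set0.
  by rewrite -card_gt0 (leq_trans _ (block_ge3 bB)).
have [i iB min_i] := arg_minnP (fun k : 'I_n => val k) i0B.
have [j0 j0B neq_j0i] := block_other block_ge3 i bB.
have Bj0 : (j0 \in B) && (j0 != i) by rewrite j0B.
have [j /andP [jB neq_ji] min_j] :=
  @arg_minnP _ j0 (fun k => (k \in B) && (k != i)) (fun k => val k) Bj0.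
have eij : e i j by rewrite (block_edge e_block bB) // eq_sym.
exists (i, j); last exact: block_pair_block.
apply/and3P; split=> //=.
  by rewrite ltn_neqAle min_i // andbT eq_sym.
apply/forallP => k; apply/implyP; rewrite ltnNge.
apply: contra => /andP [eik ejk].
apply: min_j; rewrite (block_common_neighbor e_sym e_irr bB iB jB) //=.
by apply: contraTneq eik => ->; rewrite e_irr.
Qed.

Lemma card_blocks :
  #|[set B | block e B]| = #|[set p | leading_pair p.1 p.2]|.
Proof.
rewrite -(card_in_imset pair_block_inj); congr #|pred_of_set _|.
apply/setP => B; rewrite inE; apply/idP/imsetP => [bB | [p]].
  by have [p Lp ->] := block_leading_pair bB; exists p; rewrite ?inE.
rewrite inE => /and3P [_ ep _] ->.
have [C [bC iC jC]] := edge_in_block e_sym e_irr ep.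
by rewrite (surjective_pairing p) -(block_pair_block bC).
Qed.

End CountBlocks.

(** * Running programs *)

Section Reaches.
Variables (P : program) (input : seq nat).
Implicit Types (s : state) (Q R : state -> Prop) (t : nat).

Definition reaches s t Q : Prop :=
  exists2 t', t' <= t & Q (iter t' (step P input) s).

Lemma reaches_steps t s Q : Q (iter t (step P input) s) -> reaches s t Q.
Proof. by exists t. Qed.

Lemma reaches_weaken t t' s Q : t <= t' -> reaches s t Q -> reaches s t' Q.
Proof. by move=> le_t [u le_u Qu]; exists u; rewrite ?(leq_trans le_u). Qed.

Lemma reaches_trans t t' s Q R :
  reaches s t Q -> (forall s', Q s' -> reaches s' t' R) -> reaches s (t + t') R.
Proof.
move=> [u le_u Qu] QR; have [u' le_u' Ru'] := QR _ Qu.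
by exists (u' + u); rewrite ?iterD // addnC leq_add.
Qed.

Definition at_line l (I : (nat -> nat) -> Prop) s : Prop :=
  pc s = l /\ I (memory s).

(** A loop that is tested at its last line h and whose counter is register r.  The
index c of the invariant is the number of rounds still to go; the extra step of
each round is the test. *)
Lemma reaches_loop h b r t (I : nat -> (nat -> nat) -> Prop) :
  onth P h = Some (JumpPos r b) ->
  (forall c m, I c m -> m r = c) ->
  (forall c m, I c.+1 m -> reaches (State b m) t (at_line h (I c))) ->
  forall c m, I c m -> reaches (State h m) (c * t.+1).+1 (at_line h.+1 (I 0)).
Proof.
move=> Ph Ir body; elim=> [|c IH] m Im.
  by apply: (@reaches_steps 1); rewrite /= /step Ph /= (Ir _ _ Im).
have -> : (c.+1 * t.+1).+1 = 1 + (t + (c * t.+1).+1) by rewrite mulSn add1n addnS.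
apply: (@reaches_trans _ _ _ (eq (State b m))) => [|_ <-].
  by apply: (@reaches_steps 1); rewrite /= /step Ph /= (Ir _ _ Im).
by apply: reaches_trans (body _ _ Im) _ => [[l m'] [/= -> /IH]].
Qed.

End Reaches.

(** * The program *)

(** Registers: 0 result, 1 the constant 1, 2 the order n, 13 the constant 0; for
the loop on j: 3 rounds left, 4 the value of j, 5 the address of row j; for the
loop on i < j: 6 rounds left, 7 the address of entry (j, i), 8 that of row i;
for the loop on k < j: 9 rounds left, 10 the tentative contribution of (i, j),
11 and 12 the addresses of entries (i, k) and (j, k); 14 and 15 scratch.  The
contribution starts as entry (j, i).  The sum of the entries (i, k) and (j, k),
minus 1, is subtracted from it; as subtraction is truncated, a common neighbour
k makes it 0, other k do not change it, and no branching is needed. *)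
Definition zf_program : program :=
  (* Lines 0 to 5 use that all registers are initially 0: Read r r loads n. *)
  [:: Read 0 0; Const 1 1; Read 2 2; Read 3 3; Const 5 1; JumpPos 1 32;
  (* 6: start of a round for j *)
      Const 8 1; Add 6 4 13; Add 7 5 13; JumpPos 1 28;
  (* 10: start of a round for i *)
      Add 9 4 13; Read 10 7; Add 11 8 13; Add 12 5 13; JumpPos 1 23;
  (* 15: round for k *)
      Read 14 11; Read 15 12; Add 14 14 15; Defs.Sub 14 14 1;
      Defs.Sub 10 10 14; Add 11 11 1; Add 12 12 1; Defs.Sub 9 9 1;
  (* 23: test of k *)
      JumpPos 9 15;
      Defs.Sub 0 0 10; Add 7 7 1; Add 8 8 2; Defs.Sub 6 6 1;
  (* 28: test of i *)
      JumpPos 6 10;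
      Add 4 4 1; Add 5 5 2; Defs.Sub 3 3 1;
  (* 32: test of j *)
      JumpPos 3 6].

Section ProgramCorrect.
Variables (input : seq nat).
Let n := nth 0 input 0.
Let A i j := nth 0 input (i * n + j).+1.

Definition pair_weight i j : nat :=
  A j i - \sum_(0 <= k < j) (A i k + A j k - 1).

Definition row_weight j : nat := \sum_(0 <= i < j) pair_weight i j.

(** In each invariant, c is the number of rounds to go, and z the value that the
register changed by the loop will have at its end: the current value minus the
sum of the pending contributions. *)
Definition inv_j z c (m : nat -> nat) : Prop :=
  exists j a, [/\ j + c = n,
    [seq m r | r <- [:: 1; 2; 13; 3; 4; 5; 0]] =
      [:: 1; n; 0; c; j; (j * n).+1; a]
    & a - \sum_(j <= j' < n) row_weight j' = z].

Definition inv_i cj j z c (m : nat -> nat) : Prop :=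
  exists i a, [/\ i + c = j,
    [seq m r | r <- [:: 1; 2; 13; 3; 4; 5; 6; 7; 8; 0]] =
      [:: 1; n; 0; cj; j; (j * n).+1; c; (j * n + i).+1; (i * n).+1; a]
    & a - \sum_(i <= i' < j) pair_weight i' j = z].

Definition inv_k cj j ci i a z c (m : nat -> nat) : Prop :=
  exists k b, [/\ k + c = j,
    [seq m r | r <- [:: 1; 2; 13; 3; 4; 5; 6; 7; 8; 0; 9; 11; 12; 10]] =
      [:: 1; n; 0; cj; j; (j * n).+1; ci; (j * n + i).+1; (i * n).+1; a;
          c; (i * n + k).+1; (j * n + k).+1; b]
    & b - \sum_(k <= k' < j) (A i k' + A j k' - 1) = z].

Let run := reaches zf_program input.

Lemma loop_k cj j ci i a z c m :
  inv_k cj j ci i a z c m ->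
  run (State 23 m) (c * 9).+1 (at_line 24 (inv_k cj j ci i a z 0)).
Proof.
apply: (reaches_loop (r := 9) (b := 15)) => {c m} [//|c m|c m].
  by case=> k [b [_ [*]]].
case=> k [b [Ek]]; rewrite /= => -[m1 m2 m13 m3 m4 m5 m6 m7 m8 m0 m9 m11 m12 m10].
move=> Ez; apply: (@reaches_steps _ _ 8); split=> //=.
exists k.+1, (b - (A i k + A j k - 1)); split.
- by rewrite addSnnS.
- rewrite /update /= m1 m2 m13 m3 m4 m5 m6 m7 m8 m0 m9 m10 m11 m12.
  by rewrite subn1 /= !addn1 !addnS.
- by rewrite -subnDA -Ez [in RHS]big_ltn // -Ek -addSnnS leq_addr.
Qed.

Lemma loop_i cj j z c m :
  inv_i cj j z c m ->
  run (State 28 m) (c * (9 * j + 11)).+1 (at_line 29 (inv_i cj j z 0)).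
Proof.
rewrite addnS; apply: (reaches_loop (r := 6) (b := 10)) => {c m} [//|c m|c m].
  by case=> i [a [_ [*]]].
case=> i [a [Ei]]; rewrite /= => -[m1 m2 m13 m3 m4 m5 m6 m7 m8 m0] Ez.
(* Five steps before the loop on k, and four after it. *)
rewrite (_ : 9 * j + 10 = 5 + ((j * 9).+1 + 4)); last by rewrite mulnC !addnS.
set Q := at_line 23 (inv_k cj j c.+1 i a (pair_weight i j) j).
apply: (reaches_trans (Q := Q)).
  apply: (@reaches_steps _ _ 5); split; rewrite /step /= /update /= m1 //=.
  exists 0, (A j i); split=> //.
  by rewrite /= m1 m2 m13 m3 m4 m5 m6 m7 m8 m0 !addn0.
case=> _ m' [/= -> /loop_k].
move/reaches_trans; apply=> {m m' m1 m2 m13 m3 m4 m5 m6 m7 m8 m0} -[_ m] [/= ->].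
case=> k [b [Ek]]; rewrite /= => -[m1 m2 m13 m3 m4 m5 m6 m7 m8 m0 m9 m11 m12 m10].
rewrite addn0 in Ek; rewrite Ek big_geq // subn0 => Eb.
apply: (@reaches_steps _ _ 4); split=> //=.
exists i.+1, (a - pair_weight i j); split.
- by rewrite addSnnS.
- rewrite /update /= m1 m2 m13 m3 m4 m5 m6 m7 m8 m0 m10 Eb.
  by rewrite subn1 /= !addn1 !addnS addSn mulSnr.
- by rewrite -subnDA -Ez [in RHS]big_ltn // -Ei -addSnnS leq_addr.
Qed.

Lemma loop_j z c m :
  inv_j z c m ->
  run (State 32 m) (c * (n * (9 * n + 11) + 9)).+1 (at_line 33 (inv_j z 0)).
Proof.
rewrite addnS; apply: (reaches_loop (r := 3) (b := 6)) => {c m} [//|c m|c m].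
  by case=> j [a [_ [*]]].
case=> j [a [Ej]]; rewrite /= => -[m1 m2 m13 m3 m4 m5 m0] Ez.
have lt_jn : j < n by rewrite -Ej -addSnnS leq_addr.
(* Four steps before the loop on i, and three after it. *)
apply: (@reaches_weaken _ _ (4 + ((j * (9 * j + 11)).+1 + 3))).
  rewrite -[4 + _]addnC -addnA addSnnS leq_add2r.
  by apply: leq_mul; rewrite ?leq_add2r ?leq_mul2l ltnW.
apply: (reaches_trans (Q := at_line 28 (inv_i c.+1 j (a - row_weight j) j))).
  apply: (@reaches_steps _ _ 4); split; rewrite /step /= /update /= m1 //=.
  exists 0, a; split=> //.
  by rewrite /= m1 m2 m13 m3 m4 m5 m0 !addn0.
case=> _ m' [/= -> /loop_i].
move/reaches_trans; apply=> {m m' m1 m2 m13 m3 m4 m5 m0} -[_ m] [/= ->].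
case=> i [b [Ei]]; rewrite /= => -[m1 m2 m13 m3 m4 m5 m6 m7 m8 m0].
rewrite addn0 in Ei; rewrite Ei big_geq // subn0 => Eb.
apply: (@reaches_steps _ _ 3); split=> //=.
exists j.+1, b; split.
- by rewrite addSnnS.
- rewrite /update /= m1 m2 m13 m3 m4 m5 m0.
  by rewrite subn1 /= !addn1 addSn mulSnr.
- by rewrite Eb -subnDA -Ez [in RHS]big_ltn.
Qed.

Lemma zf_program_correct :
  computes_within zf_program input (29 * n ^ 3 + 29)
    (n - \sum_(0 <= j < n) row_weight j).
Proof.
set z := n - _.
have [t le_t [pc_t [j [a [Ej]]]]] :
    run initial (6 + (n * (n * (9 * n + 11) + 9)).+1) (at_line 33 (inv_j z 0)).
  apply: (reaches_trans (Q := at_line 32 (inv_j z n))).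
    by apply: (@reaches_steps _ _ 6); split=> //=; exists 0, n.
  by case=> _ m [/= -> /loop_j].
rewrite /= addn0 in Ej *; rewrite Ej big_geq // subn0 => -[_ _ _ _ _ _ Ea] Eaz.
(* There are at most 9 n^3 + 11 n^2 + 9 n + 7 steps. *)
have {}le_t : t <= 29 * n ^ 3 + 29.
  rewrite (leq_trans le_t) // -addSnnS addnC leq_add //.
  have [-> // | n_gt0] := posnP n.
  have le1 : 9 * n + 11 <= 20 * n.
    by rewrite -[20]/(9 + 11) mulnDl leq_add2l leq_pmulr.
  have le2 : n * (9 * n + 11) + 9 <= 29 * (n * n).
    rewrite -[29]/(20 + 9) mulnDl leq_add ?leq_pmulr ?muln_gt0 ?n_gt0 //.
    by rewrite mulnCA leq_mul2l le1 orbT.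
  by rewrite -[n ^ 3]/(n * (n * n)) mulnCA leq_mul2l le2 orbT.
rewrite /computes_within -(subnK le_t) iterD.
set s := iter t _ _ in pc_t Ea *.
(* A halted machine stays where it is. *)
have -> : iter (29 * n ^ 3 + 29 - t) (step zf_program input) s = s.
  by elim: (_ - t) => //= k ->; rewrite /step pc_t.
by rewrite /halted pc_t Ea Eaz.
Qed.

End ProgramCorrect.

(** * The program on the encoding of a graph *)

Lemma nth_allpairs (S T R : Type) (f : S -> T -> R) x0 y0 z0 s t i j :
  i < size s -> j < size t ->
  nth z0 [seq f x y | x <- s, y <- t] (i * size t + j) =
    f (nth x0 s i) (nth y0 t j).
Proof.
elim: s i => [|x s IH] [|i] //= lt_is lt_jt; rewrite nth_cat size_map.
  by rewrite mul0n add0n lt_jt (nth_map y0).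
by rewrite mulSn -addnA ltnNge leq_addr /= addKn IH.
Qed.

Lemma nth_encode_graph n (e : rel 'I_n) (i j : 'I_n) :
  nth 0 (encode_graph e) (i * n + j).+1 = e i j.
Proof.
have lt_enum (k : 'I_n) : k < size (enum 'I_n) by rewrite size_enum_ord.
have := nth_allpairs (fun i j => nat_of_bool (e i j)) i j 0
  (lt_enum i) (lt_enum j).
by rewrite size_enum_ord !nth_ord_enum.
Qed.

Section BlockCount.
Variables (n : nat) (e : rel 'I_n).
Hypotheses (e_sym : symmetric e).

Lemma pair_weight_encode_graph (i j : 'I_n) :
  i < j -> pair_weight (encode_graph e) i j = leading_pair e i j.
Proof.
have n_head : nth 0 (encode_graph e) 0 = n by [].
move=> lt_ij; rewrite /pair_weight /leading_pair lt_ij n_head.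
rewrite nth_encode_graph e_sym (big_nat_widen _ _ n) 1?ltnW // big_mkord.
have [eij | //] := boolP (e i j); rewrite andTb andTb.
case: (boolP [forall _, _]) => [noC | ].
  rewrite big1 // => k lt_kj; rewrite !nth_encode_graph.
  by have := implyP (forallP noC k) lt_kj; do 2!case: (e _ k).
rewrite negb_forall => /existsP [k].
rewrite negb_imply negbK => /and3P [lt_kj eik ejk].
by rewrite (bigD1 k) // !nth_encode_graph eik ejk.
Qed.

Lemma sum_row_weight_encode_graph :
  \sum_(0 <= j < n) row_weight (encode_graph e) j =
    #|[set p | leading_pair e p.1 p.2]|.
Proof.
transitivity (\sum_(i < n) \sum_(j < n) leading_pair e i j); last first.
  rewrite pair_big -sum1dep_card [RHS]big_mkcond; apply: eq_bigr => p _.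
  by case: leading_pair.
rewrite big_mkord exchange_big; apply: eq_bigr => j _ /=.
rewrite /row_weight (big_nat_widen _ _ n) 1?ltnW // big_mkord big_mkcond /=.
apply: eq_bigr => i _; case: ifP => [lt_ij | ge_ij].
  exact: pair_weight_encode_graph.
by rewrite /leading_pair ge_ij.
Qed.
End BlockCount.

Theorem theorem3p3 :
  exists (P : program) (c k : nat),
    forall (n : nat) (e : rel 'I_n),
      symmetric e -> irreflexive e ->
      block_graph e ->
      (forall B : {set 'I_n}, block e B -> 3 <= #|B|) ->
      computes_within P (encode_graph e) (c * n ^ k + c)
        (zero_forcing_number e).
Proof.
exists zf_program, 29, 3 => n e e_sym e_irr e_block block_ge3.
rewrite zero_forcing_number_block_graph // card_ord card_blocks //.
rewrite -sum_row_weight_encode_graph //.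
exact: (zf_program_correct (encode_graph e)).
Qed.
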